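(* Let $k\ge 2$ be an integer and let $d$ be a constant. Let $H$ be a weakly connected directed graph with $k$ source components. There exists $\varepsilon_0=\Theta_{d,k}(1)$ such that any $\varepsilon_0$-tester for $H$-freeness of $n$-vertex $d$-bounded digraphs requires at least $\Omega(n^{1-1/k})$ queries in the unidirectional model.
   Context: A digraph is $d$-bounded if both its maximum outdegree and maximum indegree are at most $d$. A digraph $H$ is weakly connected if its underlying undirected graph is connected. A strongly connected component $W$ of $H$ (a maximal vertex set inducing a strongly connected subgraph) is a source component if no edge of $H$ goes from $V(H)\setminus W$ into $W$. A digraph $G$ is $H$-free if $H$ does not appear as a subgraph of $G$. An $n$-vertex digraph $G$ is $\varepsilon$-far from $H$-freeness if more than $\varepsilon d n$ edges must be modified to obtain a $d$-bounded $H$-free digraph. An $\varepsilon$-tester for $H$-freeness is a randomized algorithm that, with probability at least $2/3$, accepts every $n$-vertex $d$-bounded $H$-free digraph and rejects every $n$-vertex $d$-bounded digraph that is $\varepsilon$-far from $H$-freeness. In the unidirectional model the algorithm may only query, for a vertex $v$ and index $i$, the $i$-th outgoing neighbor of $v$ (incoming edges cannot be queried). $\Theta_{d,k}(1)$ denotes a positive quantity depending only on $d$ and $k$ (and $H$).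
   Formalization: H is additionally assumed to be d-bounded itself (digraphs are loopless); otherwise every d-bounded digraph is H-free and a tester with zero queries exists, so the claim fails. *)

(* Defs.v *)
From HB Require Import structures.
From mathcomp Require Import all_boot all_order all_algebra.
From mathcomp Require Import reals exp.
Set Implicit Arguments. Unset Strict Implicit. Unset Printing Implicit Defensive.
Import Order.TTheory GRing.Theory Num.Theory.
Local Open Scope ring_scope.

Definition dbounded (T : finType) (d : nat) (e : rel T) : Prop :=
  irreflexive e /\
  (forall v : T, (#|[set u | e v u]| <= d)%N) /\
  (forall v : T, (#|[set u | e u v]| <= d)%N).

Definition weakly_connected (T : finType) (e : rel T) : Prop :=
  forall x y : T, connect (fun a b => e a b || e b a) x y.

Definition scc_of (T : finType) (e : rel T) (x : T) : {set T} :=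
  [set y | connect e x y && connect e y x].

Definition is_scc (T : finType) (e : rel T) (W : {set T}) : bool :=
  [exists x, W == scc_of e x].

Definition is_source (T : finType) (e : rel T) (W : {set T}) : bool :=
  [forall u, forall w, ((u \notin W) && (w \in W)) ==> ~~ e u w].

Definition num_source_components (T : finType) (e : rel T) : nat :=
  #|[set W : {set T} | is_scc e W && is_source e W]|.

Definition contains (V T : finType) (eH : rel V) (eG : rel T) : Prop :=
  exists f : V -> T, injective f /\ forall x y, eH x y -> eG (f x) (f y).

Definition Hfree (V T : finType) (eH : rel V) (eG : rel T) : Prop :=
  ~ contains eH eG.

Definition edist (n : nat) (e e' : rel 'I_n) : nat :=
  #|[set p : 'I_n * 'I_n | e p.1 p.2 != e' p.1 p.2]|.

Definition far (R : realType) (eps : R) (d n : nat) (V : finType) (eH : rel V)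
    (e : rel 'I_n) : Prop :=
  forall e' : rel 'I_n, dbounded d e' -> Hfree eH e' ->
    eps * d%:R * n%:R < (edist e e')%:R.

Definition adj_rep (n : nat) := 'I_n -> seq 'I_n.

Definition edges_of (n : nat) (adj : adj_rep n) : rel 'I_n :=
  fun u v => v \in adj u.

Definition valid_rep (n d : nat) (adj : adj_rep n) : Prop :=
  (forall v, uniq (adj v)) /\ dbounded d (edges_of adj).

Definition answer (n : nat) (adj : adj_rep n) (qr : 'I_n * nat) : option 'I_n :=
  onth (adj qr.1) qr.2.

(* a deterministic adaptive query algorithm: next query as a function of
   the answers received so far; run for t queries gives the answer history *)
Fixpoint run (n : nat) (nextq : seq (option 'I_n) -> 'I_n * nat)
    (adj : adj_rep n) (t : nat) : seq (option 'I_n) :=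
  match t with
  | 0 => [::]
  | t'.+1 => let h := run nextq adj t' in rcons h (answer adj (nextq h))
  end.

(* A randomized q-query algorithm = a finite probability space (Omega, p)
   of random seeds, and for each seed a deterministic adaptive algorithm
   (nextq w) making q queries followed by a decision (dec w) (true = accept).
   Probability of acceptance on input adj: *)
Definition acc_prob (R : realType) (n : nat) (Omega : finType) (p : Omega -> R)
    (nextq : Omega -> seq (option 'I_n) -> 'I_n * nat)
    (dec : Omega -> seq (option 'I_n) -> bool) (q : nat) (adj : adj_rep n) : R :=
  \sum_(w : Omega) p w * (dec w (run (nextq w) adj q))%:R.

Definition is_distribution (R : realType) (Omega : finType) (p : Omega -> R) : Prop :=
  (forall w, 0 <= p w) /\ \sum_(w : Omega) p w = 1.

Definition is_tester (R : realType) (eps : R) (d n : nat) (V : finType) (eH : rel V)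
    (Omega : finType) (p : Omega -> R)
    (nextq : Omega -> seq (option 'I_n) -> 'I_n * nat)
    (dec : Omega -> seq (option 'I_n) -> bool) (q : nat) : Prop :=
  is_distribution p /\
  forall adj : adj_rep n, valid_rep d adj ->
    (Hfree eH (edges_of adj) -> 2 / 3 <= acc_prob p nextq dec q adj) /\
    (far eps d eH (edges_of adj) -> 2 / 3 <= 1 - acc_prob p nextq dec q adj).

(* Main.v *)
Require Import Defs.
From HB Require Import structures.
From mathcomp Require Import all_boot all_order all_algebra all_fingroup.
From mathcomp Require Import reals exp.
From mathcomp Require Import zify lra.
Set Implicit Arguments. Unset Strict Implicit. Unset Printing Implicit Defensive.
Import Order.TTheory GRing.Theory Num.Theory.

(** Take [m] blocks, each consisting of one gadget per set [x] of source
    components of [H]; a gadget is a copy of [H] in which source component [i]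
    is attached to the core (the vertices outside all source components) iff
    [#|x|] is even and [x] and a hidden set [c b] agree at [i].  A gadget is
    complete iff [x = c b] has even size.  So if every [c b] is odd, all weak
    components are smaller than [H] and the graph is [H]-free, while if every
    [c b] is even there are [m] disjoint copies of [H].  Vertex names are public,
    except that the type-[i] source bundle named [a] (the copies of source
    component [i] in all gadgets of a block) belongs to block [s i a] for a
    hidden random permutation [s i].  Since edges never enter a source
    component, a query reveals at most one value [s i a] together with one bit
    of [c (s i a)].  As long as no block has had all its [k] types of bundles
    queried, toggling an unqueried type in every [c b] exchanges the two cases
    without changing the transcript; and with [q] queries such a block appears
    with probability at most [m * 'C(q, k) / (m - q) ^ k], which is small unless
    [q] is of order at least [n ^ (1 - 1/k)]. *)

(** * Adaptive queries to a hidden instance *)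

Section Toggle.
Variable I : finType.
Implicit Types (A : {set I}) (i j : I).

Definition toggle i A : {set I} := if i \in A then A :\ i else i |: A.

Lemma odd_toggle i A : odd #|toggle i A| = ~~ odd #|A|.
Proof.
rewrite /toggle; case: ifPn => iA; last by rewrite cardsU1 iA.
by rewrite (cardsD1 i A) iA /= negbK.
Qed.

Lemma in_toggle i j A : j != i -> (j \in toggle i A) = (j \in A).
Proof. by rewrite /toggle => /negPf ji; case: ifP; rewrite !inE ji. Qed.

Lemma toggleK i : involutive (toggle i).
Proof.
move=> A; rewrite /toggle; case: (boolP (i \in A)) => iA.
  by rewrite !inE eqxx /= setD1K.
by rewrite !inE eqxx /= setU1K.
Qed.

End Toggle.

(** * How many types of bundles of one block the queries can hit *)

Section QueryGame.
Variables (I : finType) (m n : nat).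

Local Notation instance := ({ffun I -> {perm 'I_m}} * {ffun 'I_m -> {set I}})%type.

(** In an instance [w], [w.1 i a] is the block of the type-[i] bundle named [a], and [w.2 b] is the
    hidden set of block [b]. Agreement at a bundle covers all that a query to it can reveal. *)
Definition agree (w w' : instance) (p : I * 'I_m) : bool :=
  (w.1 p.1 p.2 == w'.1 p.1 p.2) &&
  ((p.1 \in w.2 (w.1 p.1 p.2)) == (p.1 \in w'.2 (w'.1 p.1 p.2))).

Variables (adj : instance -> adj_rep n) (key : 'I_n -> option (I * 'I_m)).
Hypothesis adj_local : forall w w' v,
  (forall p, key v = Some p -> agree w w' p) -> adj w v = adj w' v.
Variable nextq : seq (option 'I_n) -> 'I_n * nat.

Implicit Types (w : instance) (t : nat) (b a : 'I_m) (p : I * 'I_m).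

Let history w t := run nextq (adj w) t.
Let key_at w t := key (nextq (history w t)).1.

Fixpoint touched w t : {set I * 'I_m} :=
  if t is s.+1 then
    if key_at w s is Some p then p |: touched w s else touched w s
  else set0.

Lemma card_touched w t : #|touched w t| <= t.
Proof.
elim: t => [|t IH] /=; first by rewrite cards0.
case: (key_at w t) => [p|]; last exact: leqW.
by rewrite cardsU1 -addn1 addnC leq_add // leq_b1.
Qed.

(** Equal histories yield the same next query, and its answer depends only on the bundle with its
    key, if any, which is then touched. *)
Lemma agree_run w w' t :
  {in touched w t, forall p, agree w w' p} ->
  history w' t = history w t /\ touched w' t = touched w t.
Proof.
rewrite /history; elim: t => [//|t IH] /= ag.
have [|eh et] := IH.
  move=> p pt; apply: ag; case: (key_at w t) => [q|] //.
  by rewrite inE pt orbT.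
rewrite /key_at /history eh et; split=> //; congr (rcons _ _).
rewrite /answer (adj_local (w := w) (w' := w')) // => p kp; apply: ag.
by rewrite /key_at /history kp !inE eqxx.
Qed.

Definition hit w t b : {set I} :=
  [set i | [exists a, ((i, a) \in touched w t) && (w.1 i a == b)]].

Lemma agree_hit w w' t b :
  {in touched w t, forall p, agree w w' p} -> hit w' t b = hit w t b.
Proof.
move=> ag; apply/setP => i; rewrite !inE; apply: eq_existsb => a.
have [_ ->] := agree_run ag.
by case: (boolP ((i, a) \in _)) => //= /ag /andP[/= /eqP -> _].
Qed.

Definition fresh w t p := (key_at w t == Some p) && (p \notin touched w t).

Lemma agree_fresh w w' t p :
  {in touched w t, forall p, agree w w' p} -> fresh w' t p = fresh w t p.
Proof. by move=> /agree_run[eh et]; rewrite /fresh /key_at eh et. Qed.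

(** Pascal's rule: a fresh bundle adds its type to the hit set of its own block only. The sum over
    [p] has at most one term. *)
Lemma sum_binS_hit w t j :
  \sum_b 'C(#|hit w t.+1 b|, j.+1) =
  \sum_b 'C(#|hit w t b|, j.+1) +
  \sum_(p | fresh w t p) 'C(#|hit w t (w.1 p.1 p.2)|, j).
Proof.
have [[i a] kp|no] := pickP (fresh w t); last first.
  rewrite [X in _ + X]big_pred0 // addn0; apply: eq_bigr => b _.
  suff -> : hit w t.+1 b = hit w t b by [].
  rewrite /hit /=; case E: (key_at w t) => [p|//].
  have pt : p \in touched w t by have := no p; rewrite /fresh E eqxx => /negbFE.
  by rewrite (setUidPr _) // sub1set.
have [/eqP E nt] := andP kp.
rewrite (eq_bigl (pred1 (i, a))) ?big_pred1_eq; last first.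
  move=> p; apply/idP/eqP => [/andP[/eqP]|-> //]; rewrite E => -[->] //.
have hitS b : hit w t.+1 b = if b == w.1 i a then i |: hit w t b else hit w t b.
  apply/setP => i'; rewrite /hit /= E; case: ifPn => [/eqP ->|nb]; rewrite !inE.
    apply/existsP/orP => [[a']|[/eqP ->|/existsP[a' /andP[h1 h2]]]].
    - rewrite !inE xpair_eqE => /andP[/orP[/andP[/eqP -> _]|h] e]; first by left.
      by right; apply/existsP; exists a'; rewrite h.
    - by exists a; rewrite !inE !eqxx.
    - by exists a'; rewrite !inE h1 h2 orbT.
  apply: eq_existsb => a'; rewrite !inE xpair_eqE.
  case: (eqVneq i' i) => //= ->; case: (eqVneq a' a) => //= ->.
  by rewrite eq_sym (negPf nb) andbF.
(* Since [w.1 i] is injective, no touched bundle of type [i] shares the block of [a]. *)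
have ni : i \notin hit w t (w.1 i a).
  rewrite inE; apply/existsP => -[a' /andP[h /eqP /perm_inj e]].
  by rewrite e (negPf nt) in h.
rewrite (bigD1 (w.1 i a)) //= [in RHS](bigD1 (w.1 i a)) //= hitS eqxx.
rewrite cardsU1 ni add1n binS -!addnA; congr (_ + _); rewrite addnC; congr (_ + _).
by apply: eq_bigr => b /negPf nb; rewrite hitS nb.
Qed.

Variable Q : pred {ffun 'I_m -> {set I}}.

(** Permutations compose from left to right, so this exchanges the blocks of the bundles [a] and
    [a'] of type [i]. *)
Definition swap i a a' w : instance :=
  ([ffun i' => if i' == i then tperm a a' * w.1 i' else w.1 i']%g, w.2).

Lemma swapK i a a' : involutive (swap i a a').
Proof.
case=> s c; congr pair; apply/ffunP => i'; rewrite !ffunE; case: eqP => // _.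
by rewrite mulgA tperm2 mul1g.
Qed.

Lemma agree_swap i a a' w t :
  (i, a) \notin touched w t -> (i, a') \notin touched w t ->
  {in touched w t, forall p, agree w (swap i a a' w) p}.
Proof.
move=> na na' [i' b] bt; rewrite /agree /= !ffunE.
case: (eqVneq i' i) => [ei|_]; last by rewrite !eqxx.
rewrite permM tpermD ?eqxx //.
- by apply: contraNneq na => ->; rewrite -ei.
- by apply: contraNneq na' => ->; rewrite -ei.
Qed.

(* Conditionally on the past, a fresh bundle lies in each block with
   probability at most 1 / (m - t): exchange its block with that of any
   other untouched bundle of the same type. *)
Lemma sum_fresh_hit t j :
  (m - t) * (\sum_(w | Q w.2) \sum_(p | fresh w t p)
               'C(#|hit w t (w.1 p.1 p.2)|, j))
  <= \sum_(w | Q w.2) \sum_b 'C(#|hit w t b|, j).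
Proof.
(* [S] adds the choice of an untouched partner [a'], of the same type as [p], for the exchange. *)
pose S (f : instance -> I * 'I_m -> 'I_m -> nat) :=
  \sum_(w | Q w.2) \sum_(p | fresh w t p)
     \sum_(a' | (p.1, a') \notin touched w t) f w p a'.
have SE f : S f = \sum_p \sum_a' \sum_(w | [&& Q w.2, fresh w t p
                     & (p.1, a') \notin touched w t]) f w p a'.
  rewrite /S (exchange_big_dep predT) //=; apply: eq_bigr => p _.
  rewrite (exchange_big_dep predT) //=; apply: eq_bigr => a' _.
  by apply: eq_bigl => w; rewrite andbA.
(* For fixed [p] and [a'], the swap permutes the instances summed and preserves hit sets, but moves
   [p] to the block of [a']. *)
have S_swap : S (fun w p a' => 'C(#|hit w t (w.1 p.1 p.2)|, j)) =
              S (fun w p a' => 'C(#|hit w t (w.1 p.1 a')|, j)).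
  rewrite !SE; apply: eq_bigr => -[i a] _; apply: eq_bigr => a' _ /=.
  rewrite (reindex_inj (inv_inj (swapK i a a'))) /=.
  have sw w : fresh w t (i, a) -> (i, a') \notin touched w t ->
      {in touched w t, forall p, agree w (swap i a a' w) p}.
    by move=> /andP[_ na] na'; apply: agree_swap.
  have dir w : fresh w t (i, a) && ((i, a') \notin touched w t) ->
      fresh (swap i a a' w) t (i, a) && ((i, a') \notin touched (swap i a a' w) t).
    move=> /andP[h1 h2]; have ag := sw _ h1 h2.
    by rewrite (agree_fresh _ ag) h1; have [_ ->] := agree_run ag.
  apply: eq_big => [w|w]; last first.
    move=> /and3P[_ h1 h2]; have ag := sw _ h1 h2.
    by rewrite swapK in ag; rewrite (agree_hit _ ag) ffunE eqxx permM tpermL.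
  by congr (_ && _); apply/idP/idP => [/dir|/dir//]; rewrite swapK.
(* At most [t] bundles are touched, which leaves at least [m - t] partners. *)
apply: (@leq_trans (S (fun w p a' => 'C(#|hit w t (w.1 p.1 p.2)|, j)))).
  rewrite big_distrr /=; apply: leq_sum => w _; rewrite big_distrr /=.
  apply: leq_sum => p _; rewrite sum_nat_const leq_mul2r; apply/orP; right.
  rewrite leq_subLR -[X in X <= _](card_ord m).
  rewrite -(cardC (fun a' => (p.1, a') \in touched w t)) leq_add //.
  apply: leq_trans (card_touched w t).
  rewrite -(card_imset (mem (fun a' => (p.1, a') \in touched w t)) (f := pair p.1));
    last by move=> x y [].
  by apply: subset_leq_card; apply/subsetP => _ /imsetP[a' + ->].
(* Distinct partners lie in distinct blocks, so the sum over all blocks dominates. *)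
rewrite S_swap; apply: leq_sum => w _.
have [p kp|no] := pickP (fresh w t); last by rewrite big_pred0.
rewrite (eq_bigl (pred1 p)) ?big_pred1_eq; last first.
  move=> p'; apply/idP/eqP => [/andP[/eqP]|-> //].
  by case/andP: kp => /eqP -> _ [].
rewrite [X in _ <= X](reindex_inj (@perm_inj _ (w.1 p.1))) /=.
by rewrite big_mkcond /=; apply: leq_sum => a' _; case: ifP.
Qed.

(** Induction on [t] with Pascal's rule on both sides; each fresh bundle costs a factor [m - t],
    which is at least [m - q]. For [j = #|I|] this bounds the expected number of fully queried
    blocks. *)
Lemma sum_bin_hit q t j : t <= q ->
  (m - q) ^ j * (\sum_(w | Q w.2) \sum_b 'C(#|hit w t b|, j))
  <= m * 'C(t, j) * #|[pred w : instance | Q w.2]|.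
Proof.
elim: t j => [|t IH] [|j] tq.
- by under eq_bigr do (under eq_bigr do rewrite bin0;
     rewrite sum1_card card_ord); rewrite sum_nat_const bin0 mul1n muln1 mulnC.
- rewrite big1 ?muln0 // => w _; rewrite big1 // => b _.
  suff -> : hit w 0 b = set0 by rewrite cards0.
  by apply/setP => i; rewrite !inE; apply/existsP => -[a]; rewrite inE.
- by under eq_bigr do (under eq_bigr do rewrite bin0;
     rewrite sum1_card card_ord); rewrite sum_nat_const bin0 mul1n muln1 mulnC.
under eq_bigr do rewrite sum_binS_hit.
rewrite big_split /= mulnDr binS mulnDr mulnDl.
apply: leq_add; first exact: IH (ltnW tq).
apply: leq_trans (IH j (ltnW tq)); rewrite expnSr -mulnA; apply: leq_mul => //.
by apply: leq_trans (sum_fresh_hit t j); apply: leq_mul => //; apply/leq_sub2l/ltnW.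
Qed.

End QueryGame.

(** * Exchanging odd and even instances without changing the transcript *)

Section Coupling.
Variables (I : finType) (m n : nat).

Local Notation instance := ({ffun I -> {perm 'I_m}} * {ffun 'I_m -> {set I}})%type.

Variables (adj : instance -> adj_rep n) (key : 'I_n -> option (I * 'I_m)).
Hypothesis adj_local : forall w w' v,
  (forall p, key v = Some p -> agree w w' p) -> adj w v = adj w' v.
Variable nextq : seq (option 'I_n) -> 'I_n * nat.
Local Notation hit := (hit adj key nextq).
Local Notation touched := (touched adj key nextq).

Implicit Types (w : instance) (t : nat) (b : 'I_m).

Definition parity_class (o : bool) (c : {ffun 'I_m -> {set I}}) : bool :=
  [forall b, odd #|c b| == o].

(** The toggled type is picked from the hit set alone, which the flip preserves; this makes the flip
    an involution. *)
Definition flip t w : instance :=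
  (w.1, [ffun b => if [pick i in ~: hit w t b] is Some i
                   then toggle i (w.2 b) else w.2 b]).

Lemma agree_flip t w : {in touched w t, forall p, agree w (flip t w) p}.
Proof.
move=> [i a] pt; rewrite /agree /= eqxx ffunE; case: pickP => [i'|] /=; last by rewrite eqxx.
rewrite inE => ni; rewrite in_toggle ?eqxx //; apply: contraNneq ni => <-.
by rewrite inE; apply/existsP; exists a; rewrite pt eqxx.
Qed.

Lemma hit_flip t w b : hit (flip t w) t b = hit w t b.
Proof. exact/(agree_hit adj_local)/agree_flip. Qed.

Lemma flipK t : involutive (flip t).
Proof.
move=> w; have hw := hit_flip t w; case: w hw => s c hw; congr pair.
apply/ffunP => b; rewrite !ffunE hw; case: pickP => [i _|//]; exact: toggleK.
Qed.

Definition good t w := [forall b, hit w t b != setT].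

Lemma parity_class_flip o t w :
  good t w -> parity_class o (flip t w).2 = parity_class (~~ o) w.2.
Proof.
move=> /forallP gd; apply: eq_forallb => b; rewrite ffunE; case: pickP => [i _|no].
  by rewrite odd_toggle; case: (odd _); case: o.
by case/eqP: (gd b); apply/setP => i; have := no i; rewrite !inE => /negbFE.
Qed.

Lemma sum_good_parity (F : seq (option 'I_n) -> nat) t :
  \sum_(w : instance | parity_class true w.2 && good t w) F (run nextq (adj w) t) =
  \sum_(w : instance | parity_class false w.2 && good t w) F (run nextq (adj w) t).
Proof.
rewrite (reindex_inj (inv_inj (flipK t))) /=; apply: eq_big => w.
  have -> : good t (flip t w) = good t w by apply: eq_forallb => b; rewrite hit_flip.
  by case: (boolP (good t w)) => [/parity_class_flip ->|]; rewrite ?andbF.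
by have [-> _] := agree_run adj_local (@agree_flip t w).
Qed.

Lemma sum_parity_class_le (F : seq (option 'I_n) -> bool) t :
  \sum_(w : instance | parity_class true w.2) F (run nextq (adj w) t) <=
  \sum_(w : instance | parity_class false w.2) F (run nextq (adj w) t) +
  \sum_(w : instance | parity_class true w.2) \sum_b 'C(#|hit w t b|, #|I|).
Proof.
rewrite (bigID (good t)) /= leq_add //.
  rewrite (sum_good_parity F) [leqRHS](bigID (good t)) /=; exact: leq_addr.
rewrite [leqRHS](bigID (good t)) /= -[leqLHS]add0n leq_add //.
(* A bad instance has a fully hit block, whose binomial is 1. *)
apply: leq_sum => w /andP[_ /forallPn[b /negPn/eqP hb]].
by rewrite (bigD1 b) //= hb cardsT binn (leq_trans (leq_b1 _)).
Qed.

Lemma query_game_bound (F : seq (option 'I_n) -> bool) q :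
  (m - q) ^ #|I| *
    (\sum_(w : instance | parity_class true w.2) F (run nextq (adj w) q)) <=
  (m - q) ^ #|I| *
    (\sum_(w : instance | parity_class false w.2) F (run nextq (adj w) q)) +
  m * 'C(q, #|I|) * #|[pred w : instance | parity_class true w.2]|.
Proof.
have le_bin := sum_bin_hit adj_local nextq (parity_class true) #|I| (leqnn q).
apply: (@leq_trans ((m - q) ^ #|I| *
  (\sum_(w : instance | parity_class false w.2) F (run nextq (adj w) q) +
  \sum_(w : instance | parity_class true w.2) \sum_b 'C(#|hit w q b|, #|I|)))).
  by rewrite leq_mul2l sum_parity_class_le orbT.
by rewrite mulnDr leq_add2l.
Qed.

End Coupling.

Lemma card_parity_class (I : finType) (m : nat) : 0 < #|I| ->
  #|[pred w : {ffun I -> {perm 'I_m}} * {ffun 'I_m -> {set I}} |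
       parity_class true w.2]| =
  #|[pred w : {ffun I -> {perm 'I_m}} * {ffun 'I_m -> {set I}} |
       parity_class false w.2]|.
Proof.
case/card_gt0P => i _.
pose h (w : {ffun I -> {perm 'I_m}} * {ffun 'I_m -> {set I}}) :=
  (w.1, [ffun b => toggle i (w.2 b)]).
have hK : involutive h.
  by case=> s c; congr pair; apply/ffunP => b; rewrite !ffunE toggleK.
rewrite -!sum1_card (reindex_inj (inv_inj hK)); apply: eq_bigl => w.
by apply: eq_forallb => b; rewrite ffunE odd_toggle; case: odd.
Qed.

(** * The hard digraphs *)

Section SourceComponents.
Variables (V : finType) (eH : rel V).

Lemma scc_of_eq x y : y \in scc_of eH x -> scc_of eH y = scc_of eH x.
Proof.
rewrite inE => /andP[xy yx]; apply/setP => z; rewrite !inE; congr (_ && _).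
  by apply/idP/idP; apply: connect_trans.
by apply/idP/idP => h; apply: connect_trans h _.
Qed.

(** Label a vertex by the source component containing it, and the core by [None]. Closure under
    predecessors holds because no edge enters a source component from outside. *)
Lemma exists_source_labelling :
  exists src : V -> option 'I_(num_source_components eH),
    (forall u v i, eH u v -> src v = Some i -> src u = Some i) /\
    (forall i, exists v, src v = Some i).
Proof.
rewrite /num_source_components; set SS := [set W | _].
have sccP (i : 'I_#|SS|) x : x \in enum_val i -> enum_val i = scc_of eH x.
  have := enum_valP i; rewrite inE => /andP[/existsP[y /eqP ->] _].
  by move=> /scc_of_eq.
pose src v := [pick i : 'I_#|SS| | v \in enum_val i].
have srcE v (i : 'I_#|SS|) : v \in enum_val i -> src v = Some i.
  move=> vi; rewrite /src; case: pickP => [j vj|/(_ i)]; last by rewrite vi.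
  by congr Some; apply: enum_val_inj; rewrite (sccP _ _ vi) (sccP _ _ vj).
exists src; split=> [u v i uv|i].
  rewrite /src; case: pickP => // j vj [<-]; apply: srcE.
  have := enum_valP j; rewrite inE => /andP[_ /forallP /(_ u) /forallP /(_ v)].
  by rewrite vj uv andbT /= implybF negbK.
have := enum_valP i; rewrite inE => /andP[/existsP[x /eqP ex] _].
by exists x; apply: srcE; rewrite ex inE !connect0.
Qed.

End SourceComponents.

(** * The gadgets: locality of queries, degrees, freeness and distance *)

Section HardInstances.
Variables (V I : finType) (eH : rel V) (src : V -> option I).
Hypothesis src_closed : forall u v i, eH u v -> src v = Some i -> src u = Some i.
Hypothesis src_surj : forall i, exists v, src v = Some i.

Variables (m n : nat).
Local Notation vertex := ('I_m * {set I} * V)%type.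
Local Notation instance := ({ffun I -> {perm 'I_m}} * {ffun 'I_m -> {set I}})%type.
Variable enc : vertex -> 'I_n.
Hypothesis enc_inj : injective enc.

Implicit Types (w : instance) (p q : vertex).

Definition attached w i (x : {set I}) (a : 'I_m) : bool :=
  ~~ odd #|x| && ((i \in x) == (i \in w.2 (w.1 i a))).

(** The vertex [(a, x, v)] is a copy of [v] with gadget index [x]; [a] is a bundle name if [v] lies
    in a source and a block if [v] lies in the core. Only source-to-core edges depend on [w]. *)
Definition vedge w p q : bool :=
  [&& eH p.2 q.2, p.1.2 == q.1.2 &
    match src p.2, src q.2 with
    | Some i, None => attached w i p.1.2 p.1.1 && (q.1.1 == w.1 i p.1.1)
    | _, _ => q.1.1 == p.1.1
    end].

Definition decode (v : 'I_n) : option vertex := [pick p | enc p == v].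

Lemma encK : pcancel enc decode.
Proof.
move=> p; rewrite /decode; case: pickP => [q /eqP/enc_inj -> //|/(_ p)].
by rewrite eqxx.
Qed.

Lemma decodeK v p : decode v = Some p -> enc p = v.
Proof. by rewrite /decode; case: pickP => // q /eqP <- [->]. Qed.

(** Indices outside the image of [enc] are isolated vertices that pad the digraph to size [n]. *)
Definition hard_adj w : adj_rep n := fun v =>
  if decode v is Some p then [seq enc q | q <- enum (vedge w p)] else [::].

Definition source_key (v : 'I_n) : option (I * 'I_m) :=
  if decode v is Some p then omap (fun i => (i, p.1.1)) (src p.2) else None.

Lemma hard_adj_local w w' v :
  (forall r, source_key v = Some r -> agree w w' r) -> hard_adj w v = hard_adj w' v.
Proof.
rewrite /source_key /hard_adj; case: (decode v) => // p ag.
congr map; apply: eq_enum => q; rewrite !unfold_in /vedge.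
congr [&& _, _ & _]; case: (src p.2) ag => [i|] //= /(_ _ erefl).
by move=> /andP[/= /eqP e1 /eqP e2]; rewrite /attached e2 e1.
Qed.

Lemma edges_of_enc w p q : edges_of (hard_adj w) (enc p) (enc q) = vedge w p q.
Proof.
by rewrite /edges_of /hard_adj encK mem_map // mem_enum.
Qed.

Lemma edges_ofP w u v : edges_of (hard_adj w) u v ->
  exists p q, [/\ u = enc p, v = enc q & vedge w p q].
Proof.
rewrite /edges_of /hard_adj; case E: (decode u) => [p|//] /mapP[q].
by rewrite mem_enum => h ->; exists p, q; rewrite (decodeK E).
Qed.

(** Together with [vedge_in_inj], this lets neighbourhoods inject into those of [H], so the degree
    bounds of [H] carry over. *)
Lemma vedge_out_inj w p q q' :
  vedge w p q -> vedge w p q' -> q.2 = q'.2 -> q = q'.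
Proof.
move: q q' => [[a x] v] [[a' x'] v'] /and3P[_ /eqP/= <- h] /and3P[_ /eqP/= <- h'] e.
rewrite -e in h' *; move: h h'; case: (src p.2) => [i|]; last by move=> /eqP-> /eqP->.
case: (src v) => [j|]; first by move=> /eqP-> /eqP->.
by move=> /andP[_ /eqP->] /andP[_ /eqP->].
Qed.

Lemma vedge_in_inj w p p' q :
  vedge w p q -> vedge w p' q -> p.2 = p'.2 -> p = p'.
Proof.
move: p p' => [[a x] v] [[a' x'] v'] /and3P[_ /eqP/= -> h] /and3P[_ /eqP/= -> h'] e.
rewrite -e in h' *; move: h h'; case: (src v) => [i|]; last by move=> /eqP-> /eqP->.
case: (src q.2) => [j|]; first by move=> /eqP-> /eqP->.
by move=> /andP[_ /eqP->] /andP[_ /eqP/perm_inj ->].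
Qed.

Lemma hard_adj_valid d w : dbounded d eH -> valid_rep d (hard_adj w).
Proof.
move=> [irr [outd ind]]; split.
  by move=> v; rewrite /hard_adj; case: decode => // p; rewrite map_inj_uniq ?enum_uniq.
split; [|split].
- move=> v; apply/negP => /edges_ofP[p [q [-> /enc_inj <-]]].
  by case/and3P; rewrite irr.
- move=> v; case E: (decode v) => [p|]; last first.
    rewrite (_ : [set u | _] = set0) ?cards0 //; apply/setP => u.
    by rewrite !inE /edges_of /hard_adj E.
  have -> : [set u | edges_of (hard_adj w) v u] = enc @: [set q | vedge w p q].
    apply/setP => u; rewrite inE -(decodeK E); apply/idP/imsetP.
      by move=> /edges_ofP[p' [q [/enc_inj <- -> h]]]; exists q; rewrite ?inE.
    by move=> [q]; rewrite inE => h ->; rewrite edges_of_enc.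
  rewrite card_imset // -(card_in_imset (f := snd)); last first.
    by move=> q q'; rewrite !inE; apply: vedge_out_inj.
  apply: leq_trans (outd p.2); apply: subset_leq_card.
  by apply/subsetP => _ /imsetP[q + ->]; rewrite !inE => /and3P[].
- move=> v; case E: (decode v) => [q|]; last first.
    rewrite (_ : [set u | _] = set0) ?cards0 //; apply/setP => u.
    by rewrite !inE; apply/negP => /edges_ofP[p [q [_ ev _]]]; rewrite ev encK in E.
  have -> : [set u | edges_of (hard_adj w) u v] = enc @: [set p | vedge w p q].
    apply/setP => u; rewrite inE -(decodeK E); apply/idP/imsetP.
      by move=> /edges_ofP[p [q' [-> /enc_inj -> h]]]; exists p; rewrite ?inE.
    by move=> [p]; rewrite inE => h ->; rewrite edges_of_enc.
  rewrite card_imset // -(card_in_imset (f := snd)); last first.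
    by move=> p p'; rewrite !inE; apply: vedge_in_inj.
  apply: leq_trans (ind q.2); apply: subset_leq_card.
  by apply/subsetP => _ /imsetP[p + ->]; rewrite !inE => /and3P[].
Qed.

(* Constant on weakly connected components: an attached source lies in the
   component of its core, an unattached one is a component of its own. *)
Definition component w p : option I * 'I_m * {set I} :=
  if src p.2 is Some i then
    if attached w i p.1.2 p.1.1 then (None, w.1 i p.1.1, p.1.2)
    else (Some i, p.1.1, p.1.2)
  else (None, p.1.1, p.1.2).

Lemma component_vedge w p q : vedge w p q -> component w p = component w q.
Proof.
move: p q => [[a x] u] [[a' x'] v] /and3P[/= uv /eqP <-]; rewrite /component /=.
case Ev: (src v) => [j|]; first by rewrite (src_closed uv Ev) => /eqP ->.
by case: (src u) => [i|]; [move=> /andP[-> /eqP ->] | move=> /eqP ->].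
Qed.

Lemma component_inj w p q :
  component w p = component w q -> p.2 = q.2 -> p = q.
Proof.
move: p q => [[a x] u] [[a' x'] v] /= + e; rewrite -e /component /=.
case: (src u) => [i|]; last by case=> -> ->.
by case: ifP; case: ifP => // _ _ [ea ->]; rewrite ?ea // (perm_inj ea).
Qed.

Lemma weakly_connected_neighbor (x z : V) : weakly_connected eH -> x != z ->
  exists y, eH x y || eH y x.
Proof.
move=> wc xz; have /connectP[[|y s] /= h e] := wc x z; first by rewrite e eqxx in xz.
by exists y; case/andP: h.
Qed.

(** A copy of [H] would lie in one weak component, which has at most one copy of each vertex of [H]
    and hence would contain all of them. An unattached source has a single type, so the component
    would be a core with every type attached, forcing [x = w.2 b] to have even size. *)
Lemma hard_adj_Hfree w : 1 < #|I| -> weakly_connected eH ->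
  parity_class true w.2 -> Hfree eH (edges_of (hard_adj w)).
Proof.
move=> I2 wc /forallP oddc [f [f_inj f_edge]].
have other (i : I) : exists j, j != i.
  have : 0 < #|predC1 i| by rewrite -(ltn_add2l 1) -[1 in X in _ < X](card1 i) cardC.
  by case/card_gt0P => j; exists j.
have [i0 _] : exists i : I, i \in predT by apply/card_gt0P; apply: ltnW.
(* Every vertex of [H] has an incident edge and edges join encoded vertices only, so [f] factors
   through [enc]. *)
have [g fE] : exists g : V -> vertex, forall v, f v = enc (g v).
  apply: (@fin_all_exists V (fun=> vertex) (fun v p => f v = enc p)) => x.
  have [z xz] : exists z, x != z.
    have [j0 j0i] := other i0; have [u0 eu] := src_surj i0; have [u1 e1] := src_surj j0.
    case: (eqVneq x u0) => [->|]; last by exists u0.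
    exists u1; apply: contraNneq j0i => e; rewrite e e1 in eu.
    by case: eu => ->.
  have [y /orP[] /f_edge /edges_ofP[p [q [e1 e2 _]]]] := weakly_connected_neighbor wc xz.
    by exists p.
  by exists q.
have g_edge x y : eH x y -> vedge w (g x) (g y).
  by move=> /f_edge; rewrite !fE edges_of_enc.
have [v0 _] := src_surj i0.
have g_comp v : component w (g v) = component w (g v0).
  pose cl := [pred v | component w (g v) == component w (g v0)].
  suff cl_closed : closed (fun a b => eH a b || eH b a) cl.
    by have := closed_connect cl_closed (wc v v0); rewrite !inE eqxx => /eqP.
  by move=> x y /orP[] /g_edge /component_vedge; rewrite !inE => ->.
have h_inj : injective (fun v => (g v).2).
  move=> u v e; apply: f_inj; rewrite !fE; congr enc.
  by apply: (component_inj (w := w)) e; rewrite !g_comp.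
have h_src i : exists v, src (g v).2 = Some i.
  have [u <-] := src_surj i; have /codomP[v ->] := injF_onto h_inj u.
  by exists v.
case E: (component w (g v0)) => [[[i|] b] x].
  have [j ji] := other i; have [v ev] := h_src j.
  have := g_comp v; rewrite E /component ev; case: ifP => // _ [] e.
  by rewrite e eqxx in ji.
have full i : ~~ odd #|x| && ((i \in x) == (i \in w.2 b)).
  have [v ev] := h_src i; have := g_comp v; rewrite E /component ev.
  by case: ifP => // att [<- <-].
have xE : x = w.2 b by apply/setP => i; have /andP[_ /eqP] := full i.
by have /andP[] := full i0; rewrite xE (eqP (oddc b)).
Qed.

(** The gadget of block [b] that is complete when [w.2 b] is even; its type-[i] source bears the
    name that [w.1 i] sends to [b]. *)
Definition copy w (b : 'I_m) (v : V) : vertex :=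
  (if src v is Some i then ((w.1 i)^-1)%g b else b, w.2 b, v).

Lemma copy_inj w b b' v v' : copy w b v = copy w b' v' -> b = b' /\ v = v'.
Proof.
case=> + _ ev; rewrite -ev; by case: (src v) => [i /perm_inj|] ->.
Qed.

Lemma copy_vedge w b u v : parity_class false w.2 ->
  eH u v -> vedge w (copy w b u) (copy w b v).
Proof.
move=> /forallP evenc uv; rewrite /vedge /copy /= uv eqxx /=.
case Ev: (src v) => [j|]; first by rewrite (src_closed uv Ev).
by case: (src u) => [i|] //; rewrite /attached permKV !eqxx (eqP (evenc b)).
Qed.

(** The [m] copies are disjoint, and an [H]-free digraph misses an edge of each. *)
Lemma hard_adj_edist w (e' : rel 'I_n) : parity_class false w.2 ->
  Hfree eH e' -> m <= edist (edges_of (hard_adj w)) e'.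
Proof.
move=> evenc free.
have [g gP] : exists g : 'I_m -> V * V, forall b, eH (g b).1 (g b).2 &&
    ~~ e' (enc (copy w b (g b).1)) (enc (copy w b (g b).2)).
  apply: (@fin_all_exists 'I_m (fun=> (V * V)%type) (fun b r => eH r.1 r.2 &&
    ~~ e' (enc (copy w b r.1)) (enc (copy w b r.2)))) => b.
  apply/existsP; apply: contra_notT free => /existsPn no.
  exists (fun v => enc (copy w b v)); split=> [u v /enc_inj /copy_inj[] //|u v uv].
  by have := no (u, v); rewrite uv /= negbK.
pose h b := (enc (copy w b (g b).1), enc (copy w b (g b).2)).
have h_inj : injective h by move=> b b' [/enc_inj /copy_inj[->]].
rewrite -[leqLHS](card_ord m) -cardsT -(card_imset _ h_inj).
apply: subset_leq_card; apply/subsetP => _ /imsetP[b _ ->].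
have /andP[uv /negPf ne] := gP b.
by rewrite inE /h /= edges_of_enc copy_vedge // ne.
Qed.

End HardInstances.

(** * The lower bound *)

Lemma bin_le_exp q k : 'C(q, k) <= q ^ k.
Proof.
elim: q k => [|q IH] [|k] //; rewrite binS.
apply: leq_trans (leq_add (IH _) (IH _)) _.
rewrite expnS -mulSnr expnS leq_mul2l; apply/orP; right.
by case: k => // k; rewrite leq_exp2r.
Qed.

Local Open Scope ring_scope.

(** The average acceptance is at least 2/3 over odd instances and at most 1/3 over even ones, while
    the query game bounds the gap by [E / M]. *)
Lemma tester_query_bound (R : realType) (eps : R) (d m n q : nat) (V I : finType)
    (eH : rel V) (src : V -> option I) (enc : 'I_m * {set I} * V -> 'I_n)
    (Omega : finType) (p : Omega -> R)
    (nextq : Omega -> seq (option 'I_n) -> 'I_n * nat)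
    (dec : Omega -> seq (option 'I_n) -> bool) :
  (forall u v i, eH u v -> src v = Some i -> src u = Some i) ->
  (forall i, exists v, src v = Some i) ->
  injective enc -> (1 < #|I|)%N -> dbounded d eH -> weakly_connected eH ->
  eps * d%:R * n%:R < m%:R ->
  is_tester eps d eH p nextq dec q ->
  ((m - q) ^ #|I| <= 3 * (m * 'C(q, #|I|)))%N.
Proof.
move=> src_closed src_surj enc_inj I2 bd wc eps_m [[p0 p1] tst].
pose instance := ({ffun I -> {perm 'I_m}} * {ffun 'I_m -> {set I}})%type.
pose adj : instance -> adj_rep n := hard_adj eH src enc.
pose S o (s : Omega) : nat :=
  (\sum_(w : instance | parity_class o w.2) dec s (run (nextq s) (adj w) q))%N.
pose N := #|[pred w : instance | parity_class true w.2]|.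
have N_gt0 : (0 < N)%N.
  have [i _] : exists i : I, i \in predT by apply/card_gt0P; apply: ltnW.
  apply/card_gt0P; exists ([ffun=> 1%g], [ffun=> [set i]]).
  by rewrite inE; apply/forallP => b; rewrite ffunE cards1.
have sum_acc o : \sum_(w : instance | parity_class o w.2) acc_prob p nextq dec q (adj w)
                 = \sum_s p s * (S o s)%:R.
  rewrite /acc_prob exchange_big /=; apply: eq_bigr => s _.
  by rewrite -mulr_sumr natr_sum.
have valid w : valid_rep d (adj w) := hard_adj_valid src enc_inj w bd.
have acc_free : 2 / 3 * N%:R <= \sum_s p s * (S true s)%:R.
  rewrite -sum_acc mulr_natr -sumr_const; apply: ler_sum => w ow.
  by apply: (tst _ (valid w)).1; apply: hard_adj_Hfree.
have acc_far : \sum_s p s * (S false s)%:R <= 1 / 3 * N%:R.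
  rewrite -sum_acc /N card_parity_class ?(ltnW I2) // mulr_natr -sumr_const.
  apply: ler_sum => w ow.
  have : far eps d eH (edges_of (adj w)).
    move=> e' _ free'; apply: lt_le_trans eps_m _.
    by rewrite ler_nat; apply: hard_adj_edist.
  by move=> /(tst _ (valid w)).2; lra.
set M := ((m - q) ^ #|I|)%N; set E := (m * 'C(q, #|I|))%N.
have step s : M%:R * (S true s)%:R <= M%:R * (S false s)%:R + E%:R * N%:R :> R.
  rewrite -!natrM -natrD ler_nat.
  exact: (query_game_bound (@hard_adj_local _ _ eH src _ _ enc)).
(* The bound for each deterministic seed is averaged over [p]. *)
have : M%:R * (\sum_s p s * (S true s)%:R)
       <= M%:R * (\sum_s p s * (S false s)%:R) + E%:R * N%:R.
  have -> : E%:R * N%:R = \sum_s p s * (E%:R * N%:R) by rewrite -mulr_suml p1 mul1r.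
  rewrite !mulr_sumr -big_split /=.
  apply: ler_sum => s _; rewrite !(mulrCA M%:R) -mulrDr.
  exact: ler_wpM2l.
have M0 : 0 <= M%:R :> R by exact: ler0n.
have N0 : 0 < N%:R :> R by rewrite ltr0n.
move: acc_free acc_far; set x := \sum_s _; set y := \sum_s _ => hx hy hxy.
have hMx := ler_wpM2l M0 hx; have hMy := ler_wpM2l M0 hy.
have : M%:R * N%:R <= 3 * E%:R * N%:R :> R by lra.
by rewrite ler_pM2r // -natrM ler_nat.
Qed.

Lemma lt_powR_nat (R : realType) (a n k : nat) : (0 < k)%N ->
  a%:R < powR n%:R (1 - k%:R^-1) :> R -> (a ^ k < n ^ k.-1)%N.
Proof.
move=> k0 h; rewrite -(ltr_nat R) !natrX.
have kn0 : k%:R != 0 :> R by rewrite pnatr_eq0 -lt0n.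
have <- : powR n%:R (1 - k%:R^-1) ^+ k = n%:R ^+ k.-1 :> R.
  rewrite -powR_mulrn ?powR_ge0 // -powRrM -powR_mulrn ?ler0n //; congr powR.
  by rewrite mulrBl mul1r mulVf // -{1}(prednK k0) -natr1 addrK.
by rewrite ltrXn2r ?ler0n ?powR_ge0 -?lt0n.
Qed.

Lemma query_bound_numerics (B m n q k : nat) : (0 < B)%N -> (1 < k)%N ->
  (n < 2 * B * m)%N -> ((16 * B * q) ^ k < n ^ k.-1)%N ->
  ~ ((m - q) ^ k <= 3 * (m * 'C(q, k)))%N.
Proof.
move=> B0 k1 nm hq hm; have k0 := ltnW k1.
have n0 : (0 < n)%N.
  by case: n hq {nm} => // ; rewrite exp0n //; case: k k1 {k0 hm} => [|[]].
have qn : (16 * B * q < n)%N.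
  by rewrite -(ltn_exp2r _ _ k0); apply: leq_trans hq _; rewrite leq_pexp2l ?leq_pred.
(* From [16 * B * q < n < 2 * B * m] one gets [8 * q < m]. *)
have qm : (m <= 2 * (m - q))%N by nia.
have m0 : (0 < m)%N by nia.
have h1 : (m ^ k.-1 <= 3 * (2 * q) ^ k)%N.
  rewrite -(leq_pmul2l m0) -expnS prednK //.
  apply: leq_trans (_ : 2 ^ k * (m - q) ^ k <= _)%N.
    by rewrite -expnMn leq_exp2r.
  apply: leq_trans (_ : 2 ^ k * (3 * (m * q ^ k)) <= _)%N.
    by rewrite leq_mul2l (leq_trans hm) ?orbT // !leq_mul2l bin_le_exp !orbT.
  by rewrite expnMn; lia.
have h2 : ((8 * B) ^ k * (2 * q) ^ k < (2 * B) ^ k.-1 * (3 * (2 * q) ^ k))%N.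
  rewrite -expnMn (_ : 8 * B * (2 * q) = 16 * B * q)%N; last by lia.
  apply: leq_trans hq _; apply: leq_trans (_ : (2 * B * m) ^ k.-1 <= _)%N.
    have k1' : (0 < k.-1)%N by rewrite -ltnS prednK.
    by rewrite (leq_exp2r _ _ k1'); exact: ltnW nm.
  by rewrite expnMn leq_mul2l h1 orbT.
(* Contradiction: [(8 * B) ^ k = 4 ^ k * (2 * B) * (2 * B) ^ k.-1] exceeds [3 * (2 * B) ^ k.-1]. *)
move: h2; rewrite mulnA ltn_mul2r => /andP[_]; apply/negP; rewrite -leqNgt.
rewrite (_ : 8 * B = 4 * (2 * B))%N; last by lia.
have e2B : ((2 * B) ^ k = 2 * B * (2 * B) ^ k.-1)%N by rewrite -expnS prednK.
rewrite (expnMn 4) e2B.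
have k4 : (4 <= 4 ^ k)%N by rewrite -[X in (X <= _)%N]expn1 leq_exp2l.
rewrite mulnC mulnA leq_mul2r; apply/orP; right.
by apply: leq_trans (leq_mul k4 (_ : 2 <= _)%N) => //; lia.
Qed.

Theorem theorem2 (R : realType) (k d : nat) (V : finType) (eH : rel V) :
  (2 <= k)%N ->
  dbounded d eH ->
  weakly_connected eH ->
  num_source_components eH = k ->
  exists eps0 : R, 0 < eps0 /\
  exists c : R, 0 < c /\
  exists N : nat, forall n : nat, (N <= n)%N ->
    forall (Omega : finType) (p : Omega -> R)
           (nextq : Omega -> seq (option 'I_n) -> 'I_n * nat)
           (dec : Omega -> seq (option 'I_n) -> bool) (q : nat),
      is_tester eps0 d eH p nextq dec q ->
      c * powR n%:R (1 - k%:R^-1) <= q%:R.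
Proof.
move=> k2 bd wc ek; have [src [src_closed src_surj]] := exists_source_labelling eH.
rewrite ek in src src_closed src_surj.
(* The number of vertices in one block: [2 ^ k] gadgets, each a copy of [V]. *)
pose B := (2 ^ k * #|V|)%N.
have B0 : (0 < B)%N.
  rewrite muln_gt0 expn_gt0 /=; have [v _] := src_surj (Ordinal (ltnW k2)).
  by apply/card_gt0P; exists v.
have BR : 0 < B%:R :> R by rewrite ltr0n.
have d0 : 0 <= d%:R :> R by exact: ler0n.
(* With [n < 2 * B * m] this makes [eps0 * d * n < m]; the [+ 1] keeps the denominator positive. *)
exists (2 * B%:R * (d%:R + 1))^-1; split; first by rewrite invr_gt0; nra.
exists (16 * B%:R)^-1; split; first by rewrite invr_gt0; nra.
(* From [B] on there is at least one block, whence [n < (m + 1) * B <= 2 * B * m]. *)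
exists B => n Bn Omega p nextq dec q tst.
pose m := (n %/ B)%N.
have m0 : (0 < m)%N by rewrite divn_gt0.
have nm : (n < 2 * B * m)%N.
  have := ltn_ceil n B0; rewrite -/m => h; apply: leq_trans h _.
  by rewrite mulnAC leq_mul2r; apply/orP; right; lia.
have card_le : (#|{: 'I_m * {set 'I_k} * V}| <= n)%N.
  rewrite !card_prod card_ord -cardsT -powersetT card_powerset cardsT card_ord -mulnA.
  exact: leq_trunc_div.
pose enc (x : 'I_m * {set 'I_k} * V) := widen_ord card_le (enum_rank x).
have enc_inj : injective enc.
  by move=> x y /(congr1 val) /= e; apply/enum_rank_inj/val_inj.
rewrite leNgt; apply/negP => qlt.
apply: (@query_bound_numerics B m n q k) => //.
  apply: (@lt_powR_nat R); first exact: ltnW.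
  by move: qlt; rewrite ltr_pdivlMl ?mulr_gt0 ?ltr0n // !natrM.
have := tester_query_bound src_closed src_surj enc_inj _ bd wc _ tst.
rewrite card_ord; apply=> //.
have nmR : n%:R < 2 * B%:R * m%:R :> R by rewrite -!natrM ltr_nat.
rewrite -mulrA ltr_pdivrMl; last by nra.
have : 0 < m%:R :> R by rewrite ltr0n.
nra.
Qed.
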